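(* Let $G=\langle x\rangle\neq 1$ be a finite cyclic group and let $m\geq 2$ be an integer. Then $G$ admits an $m$-PDR of valency $3$ if and only if neither of the following holds: (i) $m=2$ and $o(x)<5$; (ii) $m=3$ and $o(x)=2$.
   Context: For a group $G$ and an integer $m\geq 2$, write $g_i$ for the element $(g,i)$ of $G\times\mathbb{Z}_m$. Given subsets $T_{i,j}\subseteq G$ for $i,j\in\mathbb{Z}_m$, the $m$-Cayley digraph $\mathrm{Cay}(G,T_{i,j}:i,j\in\mathbb{Z}_m)$ is the digraph with vertex set $G\times\mathbb{Z}_m$ and arc set $\bigcup_{i,j\in\mathbb{Z}_m}\{(g_i,(tg)_j): t\in T_{i,j},\, g\in G\}$. It is called an $m$-partite Cayley digraph if $T_{i,i}=\emptyset$ for all $i\in\mathbb{Z}_m$. A digraph is regular of valency $k$ if every vertex has out-valency $k$ and in-valency $k$. A group $G$ admits an $m$-PDR ($m$-partite digraphical representation) of valency $k$ if there exists an $m$-partite Cayley digraph $\Gamma$ over $G$ which is regular of valency $k$ and whose full automorphism group $\mathrm{Aut}(\Gamma)$ is isomorphic to $G$. $o(x)$ denotes the order of $x$. *)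

(* Defs.v *)
From mathcomp Require Import all_boot all_fingroup.
Set Implicit Arguments. Unset Strict Implicit. Unset Printing Implicit Defensive.
Local Open Scope group_scope.

(* m-Cayley digraph Cay(G, T_{i,j}) over the finite group gT (G = [set: gT]);
   vertex g_i is the pair (g, i), indices i in Z_m represented by 'I_m.
   Arc (g_i, h_j) iff h = t g for some t in T i j, i.e. h * g^-1 \in T i j. *)
Definition mcay_arc (gT : finGroupType) (m : nat) (T : 'I_m -> 'I_m -> {set gT})
  (u v : gT * 'I_m) : bool := v.1 * u.1^-1 \in T u.2 v.2.

Definition partite (gT : finGroupType) (m : nat) (T : 'I_m -> 'I_m -> {set gT}) :=
  forall i : 'I_m, T i i = set0.

Definition regular_valency (V : finType) (arc : rel V) (k : nat) :=
  forall u : V, #|[set v | arc u v]| = k /\ #|[set w | arc w u]| = k.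

Definition digraph_aut (V : finType) (arc : rel V) : {set {perm V}} :=
  [set p : {perm V} | [forall u, forall v, arc (p u) (p v) == arc u v]].

Definition admits_mPDR (gT : finGroupType) (m k : nat) :=
  exists T : 'I_m -> 'I_m -> {set gT},
    [/\ partite T, regular_valency (mcay_arc T) k &
        digraph_aut (mcay_arc T) \isog [set: gT]].

(* Main.v *)
Require Import Defs.
From mathcomp Require Import all_boot all_fingroup.
From mathcomp Require Import cyclic zify.
Local Open Scope group_scope.

Set Implicit Arguments. Unset Strict Implicit. Unset Printing Implicit Defensive.

(** The sets [T i j] are obtained from three permutations of the parts carrying
    shifts in [G], and the automorphisms are controlled through the digons (pairs
    of opposite arcs), which they preserve.  For [m >= 3] the digons form [|G|]
    disjoint paths [(g,0) - (g,1) - ... - (g,m-1)]; the remaining arcs tell the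
    end [0] from the end [m-1], so an automorphism permutes the paths and fixes
    every part, and a single arc [(g,1) -> (xg,0)] outside the digons forces the
    induced permutation of [G] to be a translation.  For [m = 2] and [|G| >= 5]
    the digons form a single [2|G|]-cycle, in which the remaining out-neighbour
    of a vertex is at distance 3 or 5 according to its part.  In the exceptional
    cases where valency 3 is possible at all, every [T i j] with [i <> j] misses at
    most one element of [G], and this yields an automorphism moving the parts. *)

(** * Automorphisms, digons and regularity of digraphs *)

Section Automorphisms.
Variables (V : finType) (arc : rel V).

Lemma digraph_autP (p : {perm V}) :
  reflect (forall u v, arc (p u) (p v) = arc u v) (p \in digraph_aut arc).
Proof.
rewrite inE; apply: (iffP forallP) => [h u v|h u].
  by move/forallP: (h u) => /(_ v)/eqP.
by apply/forallP => v; rewrite h.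
Qed.

Lemma digraph_aut_group_set : group_set (digraph_aut arc).
Proof.
apply/group_setP; split=> [|p q /digraph_autP hp /digraph_autP hq].
  by apply/digraph_autP => u v; rewrite !perm1.
by apply/digraph_autP => u v; rewrite !permM hq hp.
Qed.
Canonical digraph_aut_group := Group digraph_aut_group_set.

Definition digon : rel V := fun u v => arc u v && arc v u.

Lemma digon_aut p u v : p \in digraph_aut arc -> digon (p u) (p v) = digon u v.
Proof. by move=> /digraph_autP hp; rewrite /digon !hp. Qed.

(** The in-neighbours of [u] are its preimages under the [K] injections; these are distinct because
    [f k w = f l w] forces [k = l]. *)
Lemma regular_union_injections (K : nat) (f : 'I_K -> V -> V) :
    (forall u v, arc u v = [exists k, v == f k u]) ->
    (forall k, injective (f k)) -> (forall u, injective (f^~ u)) ->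
  regular_valency arc K.
Proof.
move=> arcE finj fdist u; split.
  rewrite -[RHS]card_ord -(card_imset predT (fdist u)).
  apply: eq_card => v; rewrite inE arcE.
  by apply/existsP/imsetP => [[k /eqP->]|[k _ ->]]; exists k.
have ginj : injective (fun k => invF (finj k) u).
  move=> k l e; apply: (fdist (invF (finj k) u)) => /=.
  by rewrite f_invF e f_invF.
rewrite -[RHS]card_ord -(card_imset predT ginj).
apply: eq_card => v; rewrite inE arcE.
apply/existsP/imsetP => [[k /eqP->]|[k _ ->]]; exists k => //.
  by rewrite invF_f.
by rewrite f_invF.
Qed.

End Automorphisms.

(** * Right translations and valencies of an m-Cayley digraph *)

Section Translations.
Variables (gT : finGroupType) (m : nat) (T : 'I_m -> 'I_m -> {set gT}).
Local Notation V := (gT * 'I_m)%type.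
Local Notation arc := (mcay_arc T).

Lemma rtrans_inj (h : gT) : injective (fun v : V => (v.1 * h, v.2)).
Proof. by move=> [g i] [g' i'] [/mulIg-> ->]. Qed.
Definition rtrans (h : gT) : {perm V} := perm (@rtrans_inj h).

Lemma rtransE h v : rtrans h v = (v.1 * h, v.2).
Proof. by rewrite permE. Qed.

Lemma rtransM : {in [set: gT] &, {morph rtrans : h k / h * k}}.
Proof.
by move=> h k _ _; apply/permP => v; rewrite permM !rtransE mulgA.
Qed.
Canonical rtrans_morphism := Morphism rtransM.

Lemma rtrans_aut h : rtrans h \in digraph_aut arc.
Proof.
apply/digraph_autP => u v; rewrite !rtransE /mcay_arc /= invMg.
by rewrite mulgA mulgK.
Qed.

Hypothesis m_gt0 : 0 < m.

Lemma injm_rtrans : 'injm rtrans.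
Proof.
apply/injmP => h k _ _ /permP/(_ (1, Ordinal m_gt0)).
by rewrite !rtransE /= !mul1g => -[].
Qed.

(** The right translations always form a faithful copy of [G] among the automorphisms, so only the
    absence of further automorphisms has to be supplied. *)
Lemma translations_isog :
    (forall p, p \in digraph_aut arc -> exists h, forall v, p v = rtrans h v) ->
  digraph_aut arc \isog [set: gT].
Proof.
move=> htr; have -> : digraph_aut arc = rtrans @* [set: gT].
  apply/setP => p; apply/idP/morphimP => [/htr[h hh]|[h _ _ ->]].
    by exists h; rewrite ?inE //; apply/permP.
  exact: rtrans_aut.
by rewrite isog_sym sub_isog // injm_rtrans.
Qed.

(* The map [(g, i) |-> (a i * g, s i)] is an automorphism which is not a translation,
   so there are more than [#|gT|] automorphisms. *)
Lemma moving_part_not_isog (s : 'I_m -> 'I_m) (a : 'I_m -> gT) (i0 : 'I_m) :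
    injective s -> s i0 != i0 ->
    (forall i j t, (a j * t * (a i)^-1 \in T (s i) (s j)) = (t \in T i j)) ->
  ~ digraph_aut arc \isog [set: gT].
Proof.
move=> sinj si0 hT /card_isog; rewrite cardsT => cardA.
have finj : injective (fun v : V => (a v.2 * v.1, s v.2)).
  by move=> [g i] [h j] /= [] + /sinj e; rewrite e => /mulgI->.
pose p : {perm V} := perm finj.
have pA : p \in digraph_aut arc.
  apply/digraph_autP => -[g i] [h j]; rewrite !permE /mcay_arc /=.
  by rewrite -(hT i j) invMg !mulgA.
have pR : p \notin rtrans @* [set: gT].
  apply/morphimP => -[h _ _ /permP/(_ (1, i0))].
  by rewrite !permE /= => -[_ e]; rewrite e eqxx in si0.
have : p |: rtrans @* [set: gT] \subset digraph_aut arc.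
  apply/subsetP => q /setU1P[->//|/morphimP[h _ _ ->]]; exact: rtrans_aut.
move=> /subset_leq_card; rewrite cardsU1 pR cardA.
by rewrite card_injm ?injm_rtrans // cardsT ltnn.
Qed.

(** The out-neighbours of [u] in part [j] form the right translate of [T u.2 j] by [u.1]. *)
Lemma out_valency u : #|[set v | arc u v]| = (\sum_j #|T u.2 j|)%N.
Proof.
rewrite -sum1dep_card (eq_bigl (fun v : V => predT v.1 && (v.1 * u.1^-1 \in T u.2 v.2))) //.
rewrite big_mkcond /= -(pair_bigA _ (fun g j => if g * u.1^-1 \in T u.2 j then 1%N else 0%N)) /=.
rewrite exchange_big; apply: eq_bigr => j _.
rewrite -big_mkcond sum1_card -(card_rcoset _ u.1).
by apply: eq_card => h; rewrite mem_rcoset.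
Qed.

Lemma in_valency v : #|[set u | arc u v]| = (\sum_i #|T i v.2|)%N.
Proof.
rewrite -sum1dep_card (eq_bigl (fun u : V => predT u.1 && (v.1 * u.1^-1 \in T u.2 v.2))) //.
rewrite big_mkcond /= -(pair_bigA _ (fun g j => if v.1 * g^-1 \in T j v.2 then 1%N else 0%N)) /=.
rewrite exchange_big; apply: eq_bigr => j _.
rewrite -big_mkcond sum1_card.
have inj : injective (fun h : gT => v.1 * h^-1).
  by move=> h k /mulgI/invg_inj.
rewrite -(card_imset _ inj); apply: eq_card => h; apply/imsetP/idP.
  by move=> [k + ->].
move=> hT; exists (h^-1 * v.1); last by rewrite invMg invgK mulKVg.
by rewrite unfold_in /= invMg invgK mulKVg.
Qed.

End Translations.

(** * Connection sets lifted from maps of the parts with shifts *)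

Section Lift.
Variables (gT : finGroupType) (m K : nat).
Variables (s : 'I_K -> 'I_m -> 'I_m) (a : 'I_K -> 'I_m -> gT).

(** A voltage construction: each index [k] gives the vertex [(g, i)] one arc, to
    [(a k i * g, s k i)]. *)
Definition lift_conn (i j : 'I_m) : {set gT} := [set a k i | k in 'I_K & s k i == j].

Lemma lift_arcP u v :
  reflect (exists k, v = (a k u.2 * u.1, s k u.2)) (mcay_arc lift_conn u v).
Proof.
case: u v => g i [h j]; apply: (iffP imsetP) => /= [[k]|[k [-> ->]]].
  by rewrite !inE /= => /eqP <- e; exists k; rewrite -e mulgKV.
by exists k; rewrite ?inE ?eqxx //= mulgK.
Qed.

Lemma lift_partite : (forall k i, s k i != i) -> partite lift_conn.
Proof.
move=> sfix i; apply/setP => t; rewrite in_set0; apply/negP => /imsetP[k].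
by rewrite !inE /= (negPf (sfix k i)).
Qed.

Lemma lift_regular :
    (forall k, injective (s k)) -> (forall i, injective (fun k => (s k i, a k i))) ->
  regular_valency (mcay_arc lift_conn) K.
Proof.
move=> sinj sdist.
apply: (@regular_union_injections _ _ _ (fun k (u : gT * 'I_m) => (a k u.2 * u.1, s k u.2))).
- move=> u v; apply/lift_arcP/existsP => [[k ->]|[k /eqP->]]; by exists k.
- by move=> k [g i] [h j] /= [] + /sinj e; rewrite e => /mulgI->.
- by move=> [g i] k l /= [/mulIg ea es]; apply: (sdist i); rewrite ea es.
Qed.

End Lift.

(** * Digraphs whose digons form disjoint paths through all parts *)

Section PathLift.
Variables (gT : finGroupType) (x : gT) (m : nat).
Variables (s : 'I_3 -> 'I_m -> 'I_m) (b : 'I_3 -> 'I_m -> bool).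
Hypotheses (x_gen : <[x]> = [set: gT]) (x_neq1 : x != 1) (m_gt1 : 1 < m).

Let a k i : gT := x ^+ b k i.
Local Notation T := (lift_conn s a).
Local Notation arc := (mcay_arc T).

Hypothesis s_inj : forall k, injective (s k).
Hypothesis s_fix : forall k i, s k i != i.
Hypothesis s_dist : forall i, injective (fun k => (s k i, b k i)).
Hypothesis s_path : forall i j : 'I_m, i.+1 = j :> nat ->
  (exists k, s k i = j /\ ~~ b k i) /\ (exists k, s k j = i /\ ~~ b k j).
(** Opposite arcs between two parts close to a digon only if their shifts multiply to 1. A mixed
    pair gives [x], hence never a digon; two trivial shifts do give one, so the parts must be
    consecutive; two shifts [x] give [x ^+ 2], which is harmless when the order exceeds 2. *)
Hypothesis s_digon : forall k l i, s l (s k i) = i -> b k i = b l (s k i) ->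
  if b k i then 2 < #[x] else (i.+1 == s k i) || ((s k i).+1 == i).
(** This arc links different paths. The next two hypotheses separate the ends: arcs out of part 0
    follow a path or reach the other end, while the last part has a shifted arc into the
    interior. *)
Hypothesis s_shift : exists k (i : 'I_m), [/\ i = 1%N :> nat, s k i = 0 :> nat & b k i].
Hypothesis s_first : forall k (i : 'I_m), i = 0 :> nat ->
  s k i = m.-1 :> nat \/ s k i = 1%N :> nat /\ ~~ b k i.
Hypothesis s_last : forall i : 'I_m, i = m.-1 :> nat ->
  exists k, 0 < s k i < m.-1 /\ b k i.

Lemma path_digonP g h (i j : 'I_m) :
  reflect (g = h /\ (i.+1 == j) || (j.+1 == i)) (digon arc (g, i) (h, j)).
Proof.
apply: (iffP andP) => [[/lift_arcP[k /= [eh ej]] /lift_arcP[l /= [eg ei]]]|[<-]].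
  move: eg; rewrite eh mulgA -{1}[g]mul1g => /mulIg/esym e.
  have := @s_digon k l i; rewrite -ej -ei => /(_ erefl).
  rewrite ej /a in e *.
  move: e; case: (b k i); case: (b l (s k i)) => e.
  - move=> /(_ erefl); have : #[x] %| 2 by rewrite order_dvdn expgS e.
    by move/dvdn_leq => /(_ isT) + lt2; rewrite leqNgt lt2.
  - by have /eqP[] := x_neq1; rewrite -e mul1g.
  - by have /eqP[] := x_neq1; rewrite -e mulg1.
  - by move=> /(_ erefl); rewrite mul1g.
case/orP => /eqP e.
- have [[k [ek bk]] [l [el bl]]] := s_path e.
  by split; apply/lift_arcP; [exists k|exists l];
    rewrite /= /a ?ek ?el ?(negPf bk) ?(negPf bl) mul1g.
- have [[k [ek bk]] [l [el bl]]] := s_path e.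
  by split; apply/lift_arcP; [exists l|exists k];
    rewrite /= /a ?ek ?el ?(negPf bk) ?(negPf bl) mul1g.
Qed.

(** Both notions are stated through arcs and digons alone, hence are preserved by automorphisms;
    they single out the path ends and, among these, part 0. *)
Let is_end (v : gT * 'I_m) := forall w w', digon arc v w -> digon arc v w' -> w = w'.
Let is_first v := is_end v /\ forall w, arc v w -> digon arc v w \/ is_end w.

Lemma is_endP g (i : 'I_m) : is_end (g, i) <-> (i : nat) = 0 \/ (i : nat) = m.-1.
Proof.
have lti := ltn_ord i; split=> [h|h [h1 i1] [h2 i2]].
  case: (ltngtP i 0) => // [i_gt0|->]; last by left.
  right; apply/eqP/negPn/negP => i_ne.
  have lt1 : i.-1 < m by lia.
  have lt2 : i.+1 < m by lia.
  have d1 : digon arc (g, i) (g, Ordinal lt1).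
    by apply/path_digonP; split=> //=; lia.
  have d2 : digon arc (g, i) (g, Ordinal lt2).
    by apply/path_digonP; split=> //=; lia.
  by have [] := h _ _ d1 d2; lia.
move=> /path_digonP[<- d1] /path_digonP[<- d2].
have lt1 := ltn_ord i1; have lt2 := ltn_ord i2.
by congr pair; apply: val_inj => /=; lia.
Qed.

Lemma is_firstP g (i : 'I_m) : is_first (g, i) <-> (i : nat) = 0.
Proof.
split=> [[/is_endP[//|ei] h]|ei].
  (* The shifted arc into the interior is neither part of a digon nor directed to an end, so the
     last part is not first. *)
  have [k [lk bk]] := s_last ei.
  have /h : arc (g, i) (a k i * g, s k i) by apply/lift_arcP; exists k.
  case=> [/path_digonP[/eqP e _]|/is_endP]; last lia.
  by move: e; rewrite /a bk expg1 -{1}[g]mul1g (inj_eq (mulIg g)) eq_sym (negPf x_neq1).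
split=> [|[h j] /lift_arcP[k /= [-> ->]]]; first by apply/is_endP; left.
case: (s_first k ei) => [e|[e nb]]; first by right; apply/is_endP; right.
by left; apply/path_digonP; rewrite /a (negPf nb) mul1g; split=> //; lia.
Qed.

Section PathAut.
Variables (p : {perm gT * 'I_m}) (pA : p \in digraph_aut arc).

Lemma is_end_aut v : is_end v -> is_end (p v).
Proof.
move=> h w w'; rewrite -[w](permKV p) -[w'](permKV p) !digon_aut // => d d'.
by rewrite (h _ _ d d').
Qed.

Lemma is_first_aut v : is_first v -> is_first (p v).
Proof.
move=> [h1 h2]; split=> [|w]; first exact: is_end_aut.
rewrite -[w](permKV p) digon_aut // (digraph_autP _ _ pA) => /h2[]; first by left.
by move/is_end_aut; right.
Qed.

Let i0 : 'I_m := Ordinal (ltnW m_gt1).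
Let pi g := (p (g, i0)).1.

(** Induction along the path: the image of [(g, i.+1)] is a digon neighbour of [(pi g, i)], and the
    neighbour in part [i.-1] is already the image of [(g, i.-1)]. *)
Lemma path_aut_fibre (i : 'I_m) g : p (g, i) = (pi g, i).
Proof.
case: i => i; elim/ltn_ind: i g => i IH g lti.
case: i IH lti => [|i] IH lti.
  have e0 : Ordinal lti = i0 by apply: val_inj.
  rewrite e0; have /is_first_aut : is_first (g, i0) by apply/is_firstP.
  rewrite /pi; case: (p _) => h j /is_firstP /= e.
  by congr pair; apply: val_inj.
have lti' : i < m by lia.
have : digon arc (p (g, Ordinal lti')) (p (g, Ordinal lti)).
  by rewrite digon_aut //; apply/path_digonP; split=> //=; rewrite eqxx.
rewrite IH //; case e: (p (g, Ordinal lti)) => [h j] /path_digonP[eh /=].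
rewrite -eh in e *; case/orP => /eqP ej; first by congr pair; apply: val_inj.
have : p (g, Ordinal lti) = p (g, Ordinal (ltn_ord j)).
  by rewrite e IH; [congr pair; apply: val_inj | lia].
by move=> /perm_inj[/=]; lia.
Qed.

(** The arc from [(g, 1)] to [(x * g, 0)] is sent to an arc between the same parts, with shift 1 or
    [x]; shift 1 would give [pi (x * g) = pi g], against injectivity. *)
Lemma path_aut_shift g : pi (x * g) = x * pi g.
Proof.
have [k [i [i1 si bi]]] := s_shift.
have ski : s k i = i0 by apply: val_inj.
have : arc (p (g, i)) (p (x * g, i0)).
  rewrite (digraph_autP _ _ pA); apply/lift_arcP; exists k.
  by rewrite /= ski /a bi.
rewrite !path_aut_fibre // => /lift_arcP[l /= [+ _]].
rewrite /a; case: (b l i) => //; rewrite mul1g => e.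
have : p (x * g, i0) = p (g, i0) by rewrite !path_aut_fibre // e.
move=> /perm_inj[/eqP]; rewrite -{2}[g]mul1g (inj_eq (mulIg g)).
by rewrite (negPf x_neq1).
Qed.

Lemma path_aut_translation v : p v = rtrans m (pi 1) v.
Proof.
case: v => g i; rewrite path_aut_fibre // rtransE /=; congr pair.
have : g \in <[x]> by rewrite x_gen inE.
case/cycleP => n ->; elim: n => [|n IH]; first by rewrite mul1g.
by rewrite expgS path_aut_shift IH mulgA.
Qed.

End PathAut.

Lemma path_lift_mPDR : admits_mPDR gT m 3.
Proof.
exists T; split; first exact: lift_partite.
  apply: lift_regular => // i k l [es eb]; apply: (@s_dist i).
  rewrite es; congr pair; move: eb; rewrite /a.
  by case: (b k i); case: (b l i) => //= /eqP; rewrite ?[1 == _]eq_sym (negPf x_neq1).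
apply: translations_isog => [|p pA]; first exact: ltnW.
by eexists; exact: path_aut_translation.
Qed.

End PathLift.

(** * Constructions with at least three parts *)

(** Index 0 runs once forward around the parts, with shift [x] only from the last part to part 0;
    indices 1 and 2 run backward, without shift and with shift [x]. The forward arcs, except the
    wrap-around ones, pair with index 1 to form the paths. *)
Definition twisted_step (m k i : nat) : nat :=
  if k == 0 then (if i.+1 == m then 0 else i.+1) else (if i == 0 then m.-1 else i.-1).
Definition twisted_shift (m k i : nat) : bool :=
  if k == 0 then i.+1 == m else k == 2.

Lemma twisted_mPDR (gT : finGroupType) (x : gT) (m : nat) :
  <[x]> = [set: gT] -> x != 1 -> 2 < m -> 2 < #[x] -> admits_mPDR gT m 3.
Proof.
move=> x_gen x_neq1 m_gt2 n_gt2.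
have bound k i : i < m -> twisted_step m k i < m.
  by rewrite /twisted_step => lti; do ![case: ifP]; lia.
pose s (k : 'I_3) (i : 'I_m) := Ordinal (bound k i (ltn_ord i)).
apply: (@path_lift_mPDR _ x m s (twisted_shift m)) => //; rewrite /s => {s}.
- lia.
- move=> k i j /(congr1 val) /= e; apply: ord_inj; move: e => /=.
  have := ltn_ord i; have := ltn_ord j; rewrite /twisted_step.
  by do ![case: ifP]; lia.
- move=> k i; rewrite -val_eqE /= /twisted_step; have := ltn_ord i.
  by do ![case: ifP]; lia.
- move=> i k l [e1 e2]; apply: ord_inj; move: e1 e2; rewrite /twisted_step /twisted_shift.
  have := ltn_ord i; have := ltn_ord k; have := ltn_ord l.
  by do ![case: ifP]; lia.
- move=> i j e; have ltj := ltn_ord j.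
  split; [exists ord0 | exists (Ordinal (isT : 1 < 3))]; split.
  + by apply: ord_inj; rewrite /= /twisted_step /=; case: ifP; lia.
  + by rewrite /twisted_shift /=; lia.
  + by apply: ord_inj; rewrite /= /twisted_step /=; case: ifP; lia.
  + by [].
- move=> k l i /(congr1 val); rewrite /= /twisted_step /twisted_shift.
  have := ltn_ord i; have := ltn_ord k; have := ltn_ord l.
  by do ![case: ifP]; lia.
- have lt1 : 1 < m by lia.
  by exists ord_max, (Ordinal lt1); split.
- move=> k i e; rewrite /= /twisted_step /twisted_shift.
  have := ltn_ord i; have := ltn_ord k.
  by do ![case: ifP]; lia.
- move=> i e; exists ord_max; rewrite /= /twisted_step /twisted_shift /=.
  by case: ifP; lia.
Qed.

(* For [|x| = 2] the previous digraph has a closed digon cycle.  Here both shifts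
   of the arcs [0 -> m-1] are used and there is no arc [m-1 -> 0]. *)
Definition chain_step (m k i : nat) : nat :=
  if k == 0 then
    (if i == 0 then 1%N else if i == 1%N then 0 else if i.+1 == m then 2 else i.+1)
  else if k == 1%N then (if i == 0 then m.-1 else i.-1)
  else (if i == 0 then m.-1 else if i == 1%N then 2 else if i == 2 then 0
        else if i == 3 then 1%N else i.-1).
Definition chain_shift (m k i : nat) : bool :=
  if k == 0 then (i == 1%N) || (i.+1 == m) else (k == 2) && (i != 1%N).

(** No two opposite arcs both carry the shift [x], so order 2 creates no extra digon. Since [m > 3],
    part 2 is interior, and the shifted arc from the last part to it tells the ends apart. *)
Lemma chain_mPDR (gT : finGroupType) (x : gT) (m : nat) :
  <[x]> = [set: gT] -> x != 1 -> 3 < m -> admits_mPDR gT m 3.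
Proof.
move=> x_gen x_neq1 m_gt3.
have bound k i : i < m -> chain_step m k i < m.
  by rewrite /chain_step => lti; do ![case: ifP => //=]; lia.
pose s (k : 'I_3) (i : 'I_m) := Ordinal (bound k i (ltn_ord i)).
apply: (@path_lift_mPDR _ x m s (chain_shift m)) => //; rewrite /s => {s}.
- lia.
- move=> k i j /(congr1 val) /= e; apply: ord_inj; move: e => /=.
  have := ltn_ord i; have := ltn_ord j; rewrite /chain_step.
  by do ![case: ifP => //=]; lia.
- move=> k i; rewrite -val_eqE /= /chain_step; have := ltn_ord i.
  by do ![case: ifP => //=]; lia.
- move=> i k l [e1 e2]; apply: ord_inj; move: e1 e2; rewrite /chain_step /chain_shift.
  have := ltn_ord i; have := ltn_ord k; have := ltn_ord l.
  by do ![case: ifP => //=]; lia.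
- move=> i j e; split; last first.
    exists (Ordinal (isT : 1 < 3)); split=> //; apply: ord_inj => /=.
    by rewrite /chain_step /=; case: ifP; lia.
  (* The path arc from part 1 to part 2 has index 2; all other forward path arcs have index 0. *)
  have [i1|i_ne1] := eqVneq (i : nat) 1%N.
    by exists ord_max; split; [apply: ord_inj|]; rewrite /= /chain_step /chain_shift i1 -?e ?i1.
  exists ord0; have := ltn_ord j; split.
    by apply: ord_inj; rewrite /= /chain_step /=; do ![case: ifP => //=]; lia.
  by rewrite /chain_shift /=; lia.
- move=> k l i /(congr1 val); rewrite /= /chain_step /chain_shift.
  have := ltn_ord i; have := ltn_ord k; have := ltn_ord l.
  by do ![case: ifP => //=]; lia.
- have lt1 : 1 < m by lia.
  by exists ord0, (Ordinal lt1); split.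
- move=> k i e; rewrite /= /chain_step /chain_shift.
  have := ltn_ord i; have := ltn_ord k.
  by do ![case: ifP => //=]; lia.
- move=> i e; exists ord0; rewrite /= /chain_step /chain_shift /=.
  by do ![case: ifP => //=]; lia.
Qed.

(** * Two parts and order at least 5 *)

Section Bipartite.
Variables (gT : finGroupType) (x : gT).
Hypotheses (x_gen : <[x]> = [set: gT]) (x_order : 4 < #[x]).

(** The shifts 1 and [x] out of part 0 are inverse to 1 and [x^-1] out of part 1 and give the digon
    cycle; the arcs with shift [x * x] are one-way chords. *)
Let a (k : 'I_3) (i : 'I_2) : gT :=
  nth 1 (if i == ord0 then [:: 1; x; x * x] else [:: 1; x^-1; x * x]) k.
Local Notation T := (lift_conn (fun _ : 'I_3 => @rev_ord 2) a).
Local Notation arc := (mcay_arc T).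
Local Notation even := (ord0 : 'I_2).
Local Notation odd := (ord_max : 'I_2).

Lemma ord2_cases (i : 'I_2) : i = even \/ i = odd.
Proof. by case: i => [[|[|//]]] lti; [left|right]; apply: ord_inj. Qed.

Lemma expx_neq k g : 0 < k < 5 -> x ^+ k * g <> g.
Proof.
move=> k_bd; rewrite -{2}[g]mul1g => /mulIg/eqP; rewrite -order_dvdn.
by move=> /dvdn_leq; lia.
Qed.

Lemma x1_neq g : x * g <> g. Proof. exact: (@expx_neq 1). Qed.
Lemma x2_neq g : x * (x * g) <> g.
Proof. by rewrite mulgA; exact: (@expx_neq 2). Qed.
Lemma x3_neq g : x * (x * (x * g)) <> g.
Proof. by have := @expx_neq 3 g isT; rewrite !expgS expg0 mulg1 !mulgA. Qed.
Lemma x4_neq g : x * (x * (x * (x * g))) <> g.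
Proof. by have := @expx_neq 4 g isT; rewrite !expgS expg0 mulg1 !mulgA. Qed.

(** Cancels common factors [x] and substitutes until some element equals its translate by one of the
    first four powers of [x]. *)
Ltac absurd_shift := exfalso;
  repeat match goal with
  | H : x * _ = x * _ |- _ => move/mulgI: H => H
  | H : ?y = _ |- _ => is_var y; subst y
  | H : _ = ?y |- _ => is_var y; subst y
  end;
  by [eapply x1_neq; eauto | eapply x2_neq; eauto | eapply x3_neq; eauto
     | eapply x4_neq; eauto].

Lemma arc_evenP g h :
  arc (g, even) (h, odd) <-> [\/ h = g, h = x * g | h = x * (x * g)].
Proof.
split=> [/lift_arcP[[[|[|[|//]]] ltk]]|h_eq].
- by case=> ->; constructor 1; rewrite mul1g.
- by case=> ->; constructor 2.
- by case=> ->; constructor 3; rewrite mulgA.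
apply/lift_arcP; case: h_eq => ->.
- by exists ord0; congr pair; rewrite ?mul1g //; apply: ord_inj.
- by exists (Ordinal (isT : 1 < 3)); congr pair; apply: ord_inj.
- by exists ord_max; congr pair; rewrite /a /= ?mulgA //; apply: ord_inj.
Qed.

Lemma arc_oddP g h :
  arc (h, odd) (g, even) <-> [\/ h = g, h = x * g | g = x * (x * h)].
Proof.
split=> [/lift_arcP[[[|[|[|//]]] ltk]]|h_eq].
- by case=> ->; constructor 1; rewrite mul1g.
- by case=> ->; constructor 2; rewrite mulKVg.
- by case=> ->; constructor 3; rewrite mulgA.
apply/lift_arcP; case: h_eq => ->.
- by exists ord0; congr pair; rewrite ?mul1g //; apply: ord_inj.
- by exists (Ordinal (isT : 1 < 3)); congr pair; rewrite /= /a /= ?mulKg //; apply: ord_inj.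
- by exists ord_max; congr pair; rewrite /a /= ?mulgA //; apply: ord_inj.
Qed.

Lemma arc_side g h i j : arc (g, i) (h, j) -> j = rev_ord i.
Proof. by case/lift_arcP => k []. Qed.

Lemma digon_evenP g h :
  digon arc (g, even) (h, odd) <-> h = g \/ h = x * g.
Proof.
split=> [/andP[/arc_evenP e1 /arc_oddP e2]|e].
  case: e1 => e1; [by left|by right|].
  (* A return arc along a chord would make [x ^+ 2], [x] or [x ^+ 4] trivial. *)
  case: e2 => e2; absurd_shift.
apply/andP; split; [apply/arc_evenP|apply/arc_oddP];
  by case: e; [constructor 1|constructor 2].
Qed.

Lemma digon_sym u v : digon arc u v = digon arc v u.
Proof. exact: andbC. Qed.

(* Holds exactly when [v] lies in part 0 and [z] is its translate by [x]. *)
Let three_walk v z := exists w1 w3,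
  [/\ digon arc v w1, digon arc w1 z, digon arc z w3, arc v w3 & ~~ digon arc v w3].

Lemma digon_side g h i j : digon arc (g, i) (h, j) -> j = rev_ord i.
Proof. by case/andP => /arc_side. Qed.

(** The chord from part 0 is closed by three steps forward along the digon cycle, the second vertex
    reached being the translate by [x]. *)
Lemma three_walk_shift g : three_walk (g, even) (x * g, even).
Proof.
exists (x * g, odd), (x * (x * g), odd); split.
- by apply/digon_evenP; right.
- by rewrite digon_sym; apply/digon_evenP; left.
- by apply/digon_evenP; right.
- by apply/arc_evenP; constructor 3.
- by apply/negP => /digon_evenP[] e; absurd_shift.
Qed.

(** Three digon steps from part 0 change the exponent of [x] by -1 to 2, and only one choice yields
    the 2 of the chord. From part 1 they change it by -2 to 1, so reaching the chord's end would
    make one of [x], ..., [x ^+ 4] trivial. *)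
Lemma three_walkP g h i j :
  three_walk (g, i) (h, j) -> [/\ i = even, j = even & h = x * g].
Proof.
have re : rev_ord even = odd by apply: ord_inj.
have ro : rev_ord odd = even by apply: ord_inj.
case=> -[g1 i1] [[g3 i3] [d1 d2 d3 a3 nd]].
have ei1 := digon_side d1; have ej := digon_side d2; have ei3 := digon_side d3.
rewrite ei3 ej ei1 in d1 d2 d3 a3 nd *.
case: (ord2_cases i) => ei; rewrite ei ?(re, ro) in d1 d2 d3 a3 nd *.
  case/arc_evenP: a3 => e3; try by case/negP: nd; apply/digon_evenP; auto.
  rewrite digon_sym in d2.
  case/digon_evenP: d3 => e3'; case/digon_evenP: d1 => e1;
    case/digon_evenP: d2 => e2; try absurd_shift; split=> //.
  by rewrite -e2.
rewrite digon_sym in d1; rewrite digon_sym in d3; rewrite digon_sym in nd.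
case/arc_oddP: a3 => e3; try by case/negP: nd; apply/digon_evenP; auto.
case/digon_evenP: d3 => e3'; case/digon_evenP: d1 => e1;
  case/digon_evenP: d2 => e2; absurd_shift.
Qed.

Lemma bipartite_mPDR : admits_mPDR gT 2 3.
Proof.
exists T; split.
- by apply: lift_partite => k i; case: (ord2_cases i) => ->.
- apply: lift_regular => [k|i k l [/eqP]]; first exact: rev_ord_inj.
  rewrite /a nth_uniq; [by move/eqP/ord_inj| by case: ifP | by case: ifP |].
  have x1 : x != 1 by apply/eqP; rewrite -[x]mulg1; exact: x1_neq.
  have xx1 : x * x != 1 by apply/eqP; rewrite -{2}[x]mulg1; exact: x2_neq.
  have xxx1 : x * x * x != 1 by apply/eqP; rewrite -mulgA -{3}[x]mulg1; exact: x3_neq.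
  have xVxx : (x^-1 == x * x) = false.
    by apply/negbTE; apply: contra xxx1 => /eqP <-; rewrite mulVg.
  have xxx : (x == x * x) = false by rewrite -{1}[x]mulg1 (inj_eq (mulgI x)) eq_sym (negPf x1).
  case: ifP => _; rewrite /= !inE ![1 == _]eq_sym ?invg_eq1.
    by rewrite (negPf x1) (negPf xx1) xxx.
  by rewrite (negPf x1) (negPf xx1) xVxx.
apply: translations_isog => // p pA.
have walk_aut v z : three_walk v z -> three_walk (p v) (p z).
  case=> w1 [w3 [d1 d2 d3 a3 nd]]; exists (p w1), (p w3).
  by rewrite !digon_aut // (digraph_autP _ _ pA).
pose pi g := (p (g, even)).1.
have pE g : p (g, even) = (pi g, even) /\ pi (x * g) = x * pi g.
  have := walk_aut _ _ (three_walk_shift g); rewrite /pi.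
  by case: (p (g, even)) => h i; case: (p _) => h' j /three_walkP[-> _ ->].
have pi_shift g : pi g = g * pi 1.
  have : g \in <[x]> by rewrite x_gen inE.
  case/cycleP => n ->; elim: n => [|n IH]; first by rewrite mul1g.
  by rewrite expgS -mulgA (pE _).2 IH.
exists (pi 1) => -[g i]; rewrite rtransE /= -pi_shift.
case: (ord2_cases i) => ->; first exact: (pE g).1.
(* The vertex [(g, odd)] is pinned down as the common digon neighbour of [(g, even)] and
   [(x^-1 * g, even)], whose images are known. *)
have d1 : digon arc (p (g, even)) (p (g, odd)).
  by rewrite digon_aut //; apply/digon_evenP; left.
have d2 : digon arc (p (x^-1 * g, even)) (p (g, odd)).
  by rewrite digon_aut //; apply/digon_evenP; right; rewrite mulKVg.
have e := (pE (x^-1 * g)).2; rewrite mulKVg in e.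
move: d1 d2; rewrite !(pE _).1; case: (p (g, odd)) => h j d1.
have ej : j = odd by rewrite (digon_side d1); apply: ord_inj.
rewrite {}ej in d1 *; move: d1.
move=> /digon_evenP[->//|]; rewrite e => e1 /digon_evenP[] e2; absurd_shift.
Qed.

End Bipartite.

(** * Nonexistence in the exceptional cases *)

Section Obstructions.
Variables (gT : finGroupType) (x : gT).
Hypothesis x_gen : <[x]> = [set: gT].

Lemma cyclic_mulgC (g h : gT) : g * h = h * g.
Proof.
have /centsP : abelian [set: gT] by rewrite -x_gen cycle_abelian.
by apply; rewrite inE.
Qed.

Lemma cyclic_order : #[x] = #|gT|.
Proof. by rewrite orderE x_gen cardsT. Qed.

Section Conn.
Variables (m : nat) (T : 'I_m -> 'I_m -> {set gT}).

(** Exactly one arc to another part is missing at each vertex [(g, i)], the one to [(a i * g, s i)].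
    Following the missing arc commutes with itself, so it preserves missing arcs and is an
    automorphism that moves the parts. *)
Lemma matching_complement_not_isog (s : 'I_m -> 'I_m) :
    0 < m -> injective s -> (forall i, s i != i) -> partite T ->
    (forall i, #|T i (s i)| = #|gT|.-1) ->
    (forall i j, j != i -> j != s i -> #|T i j| = #|gT|) ->
  ~ digraph_aut (mcay_arc T) \isog [set: gT].
Proof.
move=> m_gt0 s_inj s_fix Tpart Ts Tfull.
have gT_gt0 : 0 < #|gT| by apply/card_gt0P; exists 1.
have full i j t : j != i -> j != s i -> t \in T i j.
  move=> ji js; suff -> : T i j = [set: gT] by rewrite inE.
  by apply/eqP; rewrite eqEcard subsetT cardsT Tfull /=.
have hole i : exists a, T i (s i) == ~: [set a].
  have /eqP/cards1P[a Ta] : #|~: T i (s i)| = 1%N.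
    by apply: (@addnI #|gT|.-1); rewrite -{1}(Ts i) cardsC addn1 prednK.
  by exists a; rewrite -Ta setCK.
pose a i := xchoose (hole i).
have Ta i : T i (s i) = ~: [set a i] by apply/eqP/(xchooseP (hole i)).
apply: (@moving_part_not_isog _ _ T m_gt0 s a (Ordinal m_gt0)) => // i j t.
have [->|ji] := eqVneq j i; first by rewrite !Tpart !inE.
have [ej|js] := eqVneq j (s i); last by rewrite !full // (inj_eq s_inj).
rewrite ej !Ta !inE -mulgA -{2}[a (s i)]mulg1 (inj_eq (mulgI _)).
by rewrite -(inj_eq (mulIg (a i))) mulgKV mul1g.
Qed.

End Conn.

Lemma valency3_bipartite_order : admits_mPDR gT 2 3 -> 4 < #[x].
Proof.
case=> T [Tpart Treg Taut]; rewrite cyclic_order.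
have cardT i j : j != i -> #|T i j| = 3.
  move=> ji; have [+ _] := Treg (1, i); rewrite out_valency /= (bigD1 j) //=.
  rewrite big1 ?addn0 // => l lj; suff -> : l = i by rewrite Tpart cards0.
  by case: l i j lj ji {Tpart Treg Taut} => [[|[|//]]] ? [[|[|//]]] ? [[|[|//]]] ? //= *;
    apply: ord_inj.
have rfix i : @rev_ord 2 i != i by case: i => [[|[|]]].
have n_ge3 : 2 < #|gT| by rewrite -(cardT ord0 ord_max) // max_card.
rewrite ltnNge; apply/negP => n_le4.
have [n3|n4] : #|gT| = 3 \/ #|gT| = 4 by move: #|gT| n_ge3 n_le4 => n; lia.
  (* Order 3: the digraph is complete bipartite, and the parts can be swapped. *)
  have full i j : j != i -> T i j = [set: gT].
    by move=> ji; apply/eqP; rewrite eqEcard subsetT cardsT cardT // n3.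
  apply: (@moving_part_not_isog _ _ T _ (@rev_ord 2) (fun=> 1) ord0 _ _ _ Taut) => //.
    exact: rev_ord_inj.
  move=> i j t; have [->|ji] := eqVneq j i; first by rewrite !Tpart !inE.
  by rewrite !full ?inE // (inj_eq rev_ord_inj).
(* Order 4: each of the two connecting sets misses one element. *)
apply: (@matching_complement_not_isog _ T (@rev_ord 2) _ _ _ _ _ _ Taut) => //.
- exact: rev_ord_inj.
- by move=> i; rewrite cardT // n4.
- move=> i j ji; case: i j ji {Tpart Treg Taut} => [[|[|//]]] ? [[|[|//]]] ?.
  all: by rewrite -!val_eqE.
Qed.

Lemma ord3_cases (i : 'I_3) :
  [\/ i = ord0, i = Ordinal (isT : 1 < 3) | i = ord_max].
Proof.
case: i => [[|[|[|//]]]] lti; [constructor 1|constructor 2|constructor 3];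
  exact: ord_inj.
Qed.

(** The sizes of the [T i j] are at most 2 and sum to 3 in each row and column, so they are 1 along
    one cyclic orientation of the parts and 2 along the other. *)
Lemma valency3_tripartite_order : admits_mPDR gT 3 3 -> #[x] <> 2.
Proof.
case=> T [Tpart Treg Taut]; rewrite cyclic_order => n2.
pose o0 : 'I_3 := ord0; pose o1 : 'I_3 := Ordinal (isT : 1 < 3).
pose o2 : 'I_3 := ord_max.
have cases (i : 'I_3) : [\/ i = o0, i = o1 | i = o2] := ord3_cases i.
have sum3 (F : 'I_3 -> nat) : (\sum_i F i = F o0 + F o1 + F o2)%N.
  rewrite !big_ord_recl big_ord0 addn0 addnA.
  by congr (F _ + F _ + F _)%N; apply: ord_inj.
have card_out i : (#|T i o0| + #|T i o1| + #|T i o2|)%N = 3.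
  by have [] := Treg (1, i); rewrite out_valency sum3.
have card_in i : (#|T o0 i| + #|T o1 i| + #|T o2 i|)%N = 3.
  by have [_] := Treg (1, i); rewrite in_valency sum3.
have card_le i j : #|T i j| <= 2 by rewrite -n2 max_card.
have card0 i : #|T i i| = 0 by rewrite Tpart cards0.
have := card_out o0; have := card_out o1; have := card_out o2.
have := card_in o0; have := card_in o1; have := card_in o2.
rewrite !card0.
have := card_le o0 o1; have := card_le o0 o2.
have := card_le o1 o0; have := card_le o1 o2.
have := card_le o2 o0; have := card_le o2 o1.
move=> le21 le20 le12 le10 le02 le01 in2 in1 in0 out2 out1 out0.
(* This size decides the orientation: the sets of size 1 follow [ordS] in the first case and
   [ord_pred] in the second. *)
have [t01|t01] : #|T o0 o1| = 1%N \/ #|T o0 o1| = 2 by lia.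
- have S0 : ordS o0 = o1 by apply: ord_inj.
  have S1 : ordS o1 = o2 by apply: ord_inj.
  have S2 : ordS o2 = o0 by apply: ord_inj.
  apply: (@matching_complement_not_isog _ T (@ordS 3) _ _ _ _ _ _ Taut) => //.
  + exact: ordS_inj.
  + by move=> i; case: (ord3_cases i) => ->.
  + by move=> i; rewrite n2; case: (cases i) => ->; rewrite (S0, S1, S2); lia.
  + move=> i j; rewrite n2; case: (cases i) => ->; case: (cases j) => -> // _ _; lia.
- have P0 : ord_pred o0 = o2 by apply: ord_inj.
  have P1 : ord_pred o1 = o0 by apply: ord_inj.
  have P2 : ord_pred o2 = o1 by apply: ord_inj.
  apply: (@matching_complement_not_isog _ T (@ord_pred 3) _ _ _ _ _ _ Taut) => //.
  + exact: ord_pred_inj.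
  + by move=> i; case: (ord3_cases i) => ->.
  + by move=> i; rewrite n2; case: (cases i) => ->; rewrite (P0, P1, P2); lia.
  + move=> i j; rewrite n2; case: (cases i) => ->; case: (cases j) => -> // _ _; lia.
Qed.

End Obstructions.

(** * The characterisation, by cases on [m] and the order of [x] *)

Theorem theorem1p1 (gT : finGroupType) (x : gT) (m : nat) :
  <[x]> = [set: gT] -> x != 1 -> (2 <= m)%N ->
  admits_mPDR gT m 3 <->
  ~ ((m = 2 /\ (#[x] < 5)%N) \/ (m = 3 /\ #[x] = 2)).
Proof.
move=> x_gen x_neq1 m_ge2; split.
  move=> pdr [[em]|[em n2]]; rewrite em in pdr.
    by rewrite ltnNge (valency3_bipartite_order x_gen pdr).
  exact: valency3_tripartite_order x_gen pdr n2.
move=> not_exc.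
have n_gt1 : 1 < #[x] by rewrite order_gt1.
have [em|m_ne2] := eqVneq m 2.
  rewrite em; apply: bipartite_mPDR x_gen _.
  by rewrite ltnNge; apply/negP => n_le4; apply: not_exc; left.
have [n2|n_ne2] := eqVneq #[x] 2; last by apply: twisted_mPDR x_gen _ _ _ => //; lia.
apply: chain_mPDR x_gen x_neq1 _.
have [em|m_ne3] := eqVneq m 3; last lia.
by case: not_exc; right.
Qed.
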